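(* Let $k>1$ and let $S$ be a depth $k$ totally ordered tree with $p$ nodes. Then there is an embedding of $S$ into $U^{p,k}$.
   Context: **Totally ordered tree.** A finite rooted tree with a total order $\prec$ on the set of all its nodes such that $u\prec v$ whenever $v$ is a child of $u$. Depth $k$ means every node is at distance at most $k$ from the root. An **embedding** of a totally ordered tree $S$ into a totally ordered tree $T$ is an injective map $\tau$ from the nodes of $S$ to those of $T$ that maps root to root, such that $u\prec_S v$ iff $\tau(u)\prec_T\tau(v)$, and $u$ is a child of $v$ in $S$ iff $\tau(u)$ is a child of $\tau(v)$ in $T$. **The trees $T^{U,p,k}$.** Fix $k>1$. $T^{U,0,k}$ consists of a single root node $u_0$. For $p>0$, suppose $T^{U,p-1,k}$ has $N$ nodes $u_0\prec\cdots\prec u_{N-1}$, and let $u_{i_0}\prec u_{i_1}\prec\cdots\prec u_{i_{N'-1}}$ be its nodes at depth $<k$. Then $T^{U,p,k}$ is formed from $T^{U,p-1,k}$ by adding new nodes $u_{N+j}$ for $j=0,\dots,N'-1$, with $u_{N+j}$ a child of $u_{i_j}$, and with order $u_i\prec u_{i+1}$ for all $i$. **The trees $U^{p,k}$.** $U^{p,k}$ is formed from $T^{U,p,k}$ by extending all branches to have length exactly $k$: considering, in $\prec$-order, each leaf $u$ of $T^{U,p,k}$ at depth $k'<k$, add a path of length $k-k'$ below $u$ terminating in a leaf at depth $k$. The $\prec$-order is extended so that the new nodes come after all nodes of $T^{U,p,k}$, in the order in which they are added. *)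

(* Defs.v *)
From HB Require Import structures.
From mathcomp Require Import all_boot all_order.
Set Implicit Arguments.
Unset Strict Implicit.
Unset Printing Implicit Defensive.

(* [child u v] reads "v is a child of u".  Every non-root node has a parent   *)
(* because it is reachable from the root.                                     *)
Record totree := Totree {
  node_disp : Order.disp_t;
  node :> finOrderType node_disp;
  root : node;
  child : rel node;
  root_no_parent : forall u, ~~ child u root;
  parent_unique : forall u v w, child u w -> child v w -> u = v;
  root_connect : forall v, connect child root v;
  child_lt : forall u v, child u v -> (u < v)%O
}.

Section Depth.
Variable T : totree.
Implicit Types (v : T) (n : nat).

Definition at_walk v n :=
  [exists q : n.-tuple T, path (@child T) (root T) q && (last (root T) q == v)].

Lemma at_walkP v n :
  reflect (exists q, [/\ path (@child T) (root T) q, last (root T) q = v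
                       & size q = n]) (at_walk v n).
Proof.
apply: (iffP existsP) => [[q /andP[qP /eqP qv]]|[q [qP qv /eqP qn]]].
  by exists q; rewrite size_tuple.
by exists (Tuple qn); rewrite /= qP qv eqxx.
Qed.

Lemma ex_walk v : exists n, at_walk v n.
Proof.
have /connectP[q qP qv] := root_connect v.
by exists (size q); apply/at_walkP; exists q.
Qed.

(* The distance from the root.                                                *)
Definition depth v : nat := ex_minn (ex_walk v).

Lemma walk_unique q1 q2 :
  path (@child T) (root T) q1 -> path (@child T) (root T) q2 ->
  last (root T) q1 = last (root T) q2 -> q1 = q2.
Proof.
elim/last_ind: q1 q2 => [|q1 x IH] q2; case/lastP: q2 => [|q2 y] //=;
  rewrite ?rcons_path ?last_rcons.
- by move=> _ /andP[_ c] ry; move: c; rewrite -ry (negPf (root_no_parent _)).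
- by move=> /andP[_ c] _ xr; move: c; rewrite xr (negPf (root_no_parent _)).
move=> /andP[P1 c1] /andP[P2 c2] xy; rewrite -{}xy in c2 *.
by rewrite (IH _ P1 P2 (parent_unique c1 c2)).
Qed.

Lemma depth_walk v n : at_walk v n -> depth v = n.
Proof.
move=> /at_walkP[q [qP qv <-]]; rewrite /depth.
case: ex_minnP => m /at_walkP[q' [qP' qv' <-]] _.
by rewrite (walk_unique qP' qP) // qv.
Qed.

End Depth.

Definition depth_at_most (k : nat) (T : totree) : Prop :=
  forall v : T, depth v <= k.

Definition embedding (S T : totree) (tau : S -> T) : Prop :=
  [/\ injective tau,
      tau (root S) = root T,
      forall u v, (u < v)%O <-> (tau u < tau v)%O
    & forall u v, child v u <-> child (tau v) (tau u)].

(* A sequence s of natural numbers encodes the tree with nodes                *)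
(* u_0 < u_1 < ... < u_(size s), where u_0 is the root and the parent of      *)
(* u_(i+1) has index nth 0 s i; so [rcons s j] adds a new last node, a child  *)
(* of u_j.                                                                    *)
Definition wf_code (s : seq nat) : Prop :=
  forall i, i < size s -> nth 0 s i <= i.

Definition code_child (s : seq nat) : rel 'I_(size s).+1 :=
  fun i j => (0 < j) && (nth 0 s j.-1 == i).

Section CodeTree.
Variables (s : seq nat) (sP : wf_code s).

Lemma code_root_no_parent i : ~~ @code_child s i ord0.
Proof. by []. Qed.

Lemma code_parent_unique i j l :
  @code_child s i l -> @code_child s j l -> i = j.
Proof.
by move=> /andP[_ /eqP il] /andP[_ /eqP jl]; apply: val_inj; rewrite /= -il -jl.
Qed.

Lemma code_child_lt (i j : 'I_(size s).+1) : @code_child s i j -> (i < j)%O.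
Proof.
case: j => -[//|j] jP /andP[_ /= /eqP ij].
by rewrite ltEord /= -ij ltnS sP.
Qed.

Lemma code_root_connect i : connect (@code_child s) ord0 i.
Proof.
case: i => i; have [n] := ubnP i; elim: n i => // n IH [|i] ltin iP.
  by rewrite (_ : Ordinal iP = ord0) ?connect0 //; apply: val_inj.
have le_i := sP (iP : i < size s).
have pP : nth 0 s i < (size s).+1 by rewrite (leq_ltn_trans le_i) // ltnW.
apply: connect_trans (IH _ (leq_ltn_trans le_i ltin) pP) _.
by apply: connect1; rewrite /code_child /=.
Qed.

Definition tree_of_code : totree :=
  @Totree _ 'I_(size s).+1 ord0 (@code_child s)
    code_root_no_parent code_parent_unique code_root_connect code_child_lt.

End CodeTree.

(* The depths of u_0, u_1, ..., in order; see code_depthE.                    *)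
Definition depths (s : seq nat) : seq nat :=
  foldl (fun ds j => rcons ds (nth 0 ds j).+1) [:: 0] s.

Definition code_depth (s : seq nat) (i : nat) : nat := nth 0 (depths s) i.

Lemma depths_rcons s j :
  depths (rcons s j) = rcons (depths s) (nth 0 (depths s) j).+1.
Proof. by rewrite /depths -cats1 foldl_cat. Qed.

Lemma size_depths s : size (depths s) = (size s).+1.
Proof.
by elim/last_ind: s => // s j IH; rewrite depths_rcons !size_rcons IH.
Qed.

Lemma code_depth0 s : code_depth s 0 = 0.
Proof.
rewrite /code_depth; elim/last_ind: s => // s j IH.
by rewrite depths_rcons nth_rcons size_depths.
Qed.

Lemma code_depthS s i : wf_code s -> i < size s ->
  code_depth s i.+1 = (code_depth s (nth 0 s i)).+1.
Proof.
rewrite /code_depth; elim/last_ind: s => // s j IH sP.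
have sP' : wf_code s.
  move=> l ls; have := sP l; rewrite size_rcons nth_rcons ls; apply.
  exact: ltnW.
have jP : j <= size s.
  by have := sP (size s); rewrite size_rcons nth_rcons ltnn eqxx; apply.
rewrite size_rcons ltnS leq_eqVlt depths_rcons !nth_rcons size_depths.
case/predU1P => [->|ls]; first by rewrite !ltnn !eqxx ltnS jP.
by rewrite ltnS ls ltnS (leq_trans (sP' _ ls) (ltnW ls)) IH.
Qed.

Lemma code_depthE s (sP : wf_code s) (v : tree_of_code sP) :
  depth v = code_depth s (v : 'I_(size s).+1).
Proof.
apply: depth_walk; apply/at_walkP.
case: v => i; have [n] := ubnP i; elim: n i => // n IH [|i] ltin iP.
  by exists [::]; rewrite /= code_depth0; split=> //; apply: val_inj.
have le_i := sP i (iP : i < size s).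
have pP : nth 0 s i < (size s).+1 by rewrite (leq_ltn_trans le_i) // ltnW.
have [q [qP qv qn]] := IH _ (leq_ltn_trans le_i ltin) pP.
exists (rcons q (Ordinal iP)).
rewrite rcons_path last_rcons size_rcons qP qv qn /= code_depthS //.
by rewrite /code_child /= eqxx.
Qed.

Fixpoint TU_code (k p : nat) : seq nat :=
  if p is p'.+1 then
    let s := TU_code k p' in
    s ++ [seq i <- iota 0 (size s).+1 | code_depth s i < k]
  else [::].

(* Hang a path of l new nodes below u_j.                                      *)
Fixpoint add_path (l j : nat) (s : seq nat) : seq nat :=
  if l is l'.+1 then add_path l' (size s).+1 (rcons s j) else s.

(* u_j is a leaf iff j is not the index of the parent of any node.            *)
Definition short_leaves (k : nat) (s : seq nat) : seq nat :=
  [seq j <- iota 0 (size s).+1 | (j \notin s) && (code_depth s j < k)].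

Definition extend_branches (k : nat) (s : seq nat) : seq nat :=
  foldl (fun t j => add_path (k - code_depth s j) j t) s (short_leaves k s).

Lemma wf_cat s t : wf_code s -> all (leq^~ (size s)) t -> wf_code (s ++ t).
Proof.
move=> sP /allP tP i; rewrite size_cat nth_cat => ist.
case: (ltnP i (size s)) => [|si]; first exact: sP.
have tle : nth 0 t (i - size s) <= size s.
  by apply/tP/mem_nth; rewrite ltn_subLR.
exact: leq_trans tle si.
Qed.

Lemma wf_TU_code k p : wf_code (TU_code k p).
Proof.
elim: p => // p IH; apply: (wf_cat IH); apply/allP => i.
by rewrite mem_filter mem_iota => /andP[_].
Qed.

Lemma wf_add_path l j s : wf_code s -> j <= size s ->
  wf_code (add_path l j s) /\ size s <= size (add_path l j s).
Proof.
elim: l j s => [|l IH] j s sP js //=.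
have [||wf le] := IH (size s).+1 (rcons s j); rewrite ?size_rcons //.
  by rewrite -cats1; apply: wf_cat => //=; rewrite js.
by split=> //; apply: leq_trans le; rewrite size_rcons.
Qed.

Lemma wf_extend_branches k s : wf_code s -> wf_code (extend_branches k s).
Proof.
move=> sP; rewrite /extend_branches; set f := fun t j => _.
have: all (leq^~ (size s)) (short_leaves k s).
  by apply/allP => j; rewrite mem_filter mem_iota => /andP[_].
suff: forall r t, wf_code t -> size s <= size t ->
    all (leq^~ (size s)) r -> wf_code (foldl f t r).
  by move=> H leS; apply: H.
elim=> [|j r IH] t tP st //= /andP[js rs].
have [wf le] := wf_add_path (k - code_depth s j) tP (leq_trans js st).
by apply: IH => //; apply: leq_trans le.
Qed.

Definition TU (p k : nat) : totree := tree_of_code (@wf_TU_code k p).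

Definition U (p k : nat) : totree :=
  tree_of_code (wf_extend_branches (k := k) (@wf_TU_code k p)).

(* Main.v *)
Require Import Defs.
From mathcomp Require Import all_boot all_order.
Set Implicit Arguments.
Unset Strict Implicit.
Unset Printing Implicit Defensive.
(* The second import of Defs makes [root] visible again: fingraph hides it. *)
Import Order.TTheory Defs.

(** The i-th node of S in the order can always be sent to a node created at
    stage i of the construction of T^{U,p,k}: its parent is mapped to a node
    that already exists and has depth < k, so it receives a new child at that
    stage. Later stages create only larger nodes, hence the order is
    preserved. Both later stages and the extension of branches append nodes at
    the end of the code, so the image survives in U^{p,k}. *)

Section RootedTree.
Variable T : totree.
Implicit Types u v : T.

Lemma root_or_child u : u = root T \/ exists v, child v u.
Proof.
have /connectP[q] := root_connect u.
case/lastP: q => [|q x] /=; first by move=> _ ->; left.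
rewrite rcons_path last_rcons => /andP[_ c] ->; right.
by exists (last (root T) q).
Qed.

Lemma depth_root : depth (root T) = 0.
Proof. by apply: depth_walk; apply/at_walkP; exists [::]. Qed.

Lemma depth_child v u : child v u -> depth u = (depth v).+1.
Proof.
move=> c; have /connectP[q qP qv] := root_connect v.
have -> : depth v = size q by apply: depth_walk; apply/at_walkP; exists q.
apply: depth_walk; apply/at_walkP; exists (rcons q u).
by rewrite rcons_path last_rcons size_rcons qP -qv.
Qed.

(** The order increases along every path from the root. *)
Lemma root_le u : (root T <= u)%O.
Proof.
have /connectP[q] := root_connect u.
elim/last_ind: q u => [|q x IH] u /=; first by move=> _ ->.
rewrite rcons_path last_rcons => /andP[qP /child_lt /ltW c] ->.
exact: le_trans (IH _ qP erefl) c.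
Qed.

Definition rank u : nat := Order.enum_rank u.

Lemma rank_mono u v : (rank u < rank v) = (u < v)%O.
Proof. exact: (leW_mono (Order.EnumVal.le_enum_rank (@le_total _ T))). Qed.

Lemma rank_card u : rank u < #|T|.
Proof. exact: ltn_ord. Qed.

(** The default value is reached only at the root. *)
Definition parent u : T := odflt (root T) [pick v | child v u].

Lemma parentE v u : child v u -> parent u = v.
Proof.
rewrite /parent => c; case: pickP => [w cw|/(_ v)]; last by rewrite c.
exact: parent_unique cw c.
Qed.

End RootedTree.

(** Appending a node appends one depth and leaves the earlier ones unchanged. *)
Lemma depths_prefix s t : prefix s t -> prefix (depths s) (depths t).
Proof.
case/prefixP=> r ->; elim/last_ind: r => [|r j IH].
  by rewrite cats0 prefix_refl.
rewrite -rcons_cat depths_rcons; apply: prefix_trans IH _.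
exact: prefix_rcons.
Qed.

Lemma nth_prefix s t i : prefix s t -> i < size s -> nth 0 t i = nth 0 s i.
Proof. by case/prefixP=> r -> ltis; rewrite nth_cat ltis. Qed.

Lemma code_depth_prefix s t i :
  prefix s t -> i <= size s -> code_depth t i = code_depth s i.
Proof.
by move=> st leis; apply: nth_prefix (depths_prefix st) _; rewrite size_depths.
Qed.

Lemma TU_code_prefix k m n : m <= n -> prefix (TU_code k m) (TU_code k n).
Proof.
move=> /subnK <-; elim: (n - m) => [|l IH]; first exact: prefix_refl.
exact: prefix_trans IH (prefix_prefix _ _).
Qed.

Lemma add_path_prefix l j s : prefix s (add_path l j s).
Proof.
elim: l j s => [|l IH] j s; first exact: prefix_refl.
exact: prefix_trans (prefix_rcons _ _) (IH _ _).
Qed.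

Lemma extend_branches_prefix k s : prefix s (extend_branches k s).
Proof.
rewrite /extend_branches; set f := fun t j => _.
suff H r t : prefix t (foldl f t r) by exact: H.
elim: r t => [|j r IH] t; first exact: prefix_refl.
exact: prefix_trans (add_path_prefix _ _ _) (IH _).
Qed.

Section Stages.
Variable k : nat.

(** Index of the child that stage [n.+1] gives to $u_i$: the new nodes follow the old ones, in the
    order of their parents. If $u_i$ is not eligible, [index] runs past the list and the value is
    junk. *)
Definition new_child n i : nat :=
  let s := TU_code k n in
  (size s).+1 + index i [seq j <- iota 0 (size s).+1 | code_depth s j < k].

Lemma new_child_gt n i : size (TU_code k n) < new_child n i.
Proof. by rewrite /new_child /= addSn ltnS leq_addr. Qed.

Lemma new_childP n i (s := TU_code k n) :
  i <= size s -> code_depth s i < k ->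
  new_child n i <= size (TU_code k n.+1)
  /\ nth 0 (TU_code k n.+1) (new_child n i).-1 = i.
Proof.
move=> le_i dk; rewrite /new_child -/s; set L := [seq j <- _ | _].
have iL : i \in L by rewrite mem_filter dk mem_iota.
have -> : TU_code k n.+1 = s ++ L by [].
rewrite size_cat addSn -addnS leq_add2l index_mem iL.
by rewrite addnS /= nth_cat ltnNge leq_addr addKn /= nth_index.
Qed.

Variable S : totree.
Hypothesis S_depth : depth_at_most k S.
Implicit Types u v : S.

(** Recursion up to the root with the depth as fuel. Since [new_child n] refers to stage [n.+1], the
    predecessor of the rank makes a node of rank $r$ appear at stage $r$. *)
Fixpoint place_at d u : nat :=
  if d is d'.+1 then new_child (rank u).-1 (place_at d' (parent u)) else 0.

Definition place u := place_at (depth u) u.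

Lemma place_root : place (root S) = 0.
Proof. by rewrite /place depth_root. Qed.

Lemma place_child v u : child v u -> place u = new_child (rank u).-1 (place v).
Proof. by move=> c; rewrite /place (depth_child c) /= (parentE c). Qed.

(** As [v] precedes [u], its image exists one stage before [rank u]; its depth is below [k] because
    the child [u] has depth at most [k]. The facts about [v] are hypotheses so that the induction in
    [place_stage] can supply them. *)
Lemma place_child_stage v u (s := TU_code k (rank u)) :
    child v u ->
    place v <= size (TU_code k (rank v)) ->
    code_depth (TU_code k (rank v)) (place v) = depth v ->
  [/\ place u <= size s, nth 0 s (place u).-1 = place v
    & code_depth s (place v) = depth v].
Proof.
move=> c le_v dv; have := child_lt c; rewrite -rank_mono /s (place_child c).
case: (rank u) => // n; rewrite ltnS /= => le_n.
have st := TU_code_prefix k le_n.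
have le_v' := leq_trans le_v (size_prefix st).
have dv' : code_depth (TU_code k n) (place v) = depth v.
  by rewrite (code_depth_prefix st).
have dk : code_depth (TU_code k n) (place v) < k.
  by rewrite dv' -(depth_child c) S_depth.
have [le_u nth_u] := new_childP le_v' dk.
by split=> //; rewrite (code_depth_prefix (TU_code_prefix k (leqnSn n))).
Qed.

Lemma place_stage u :
  place u <= size (TU_code k (rank u))
  /\ code_depth (TU_code k (rank u)) (place u) = depth u.
Proof.
have [n] := ubnP (rank u); elim: n u => // n IH u.
rewrite ltnS => le_u; have [->|[v c]] := root_or_child u.
  by rewrite place_root code_depth0 depth_root.
have lt_v : rank v < n by apply: leq_trans le_u; rewrite rank_mono child_lt.
have [le_v dv] := IH _ lt_v.
have [le nth_u d] := place_child_stage c le_v dv.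
split=> //; have: 0 < place u by rewrite (place_child c).
case: (place u) le nth_u => // x le nth_u _.
by rewrite code_depthS ?nth_u ?d ?(depth_child c) //; apply: wf_TU_code.
Qed.

(** The image of [u] is present by stage [(rank v).-1], and that of [v] is numbered beyond all nodes
    of that stage. *)
Lemma place_lt u v : (u < v)%O -> place u < place v.
Proof.
move=> uv; have [vr|[w c]] := root_or_child v.
  by have := le_lt_trans (root_le u) uv; rewrite vr ltxx.
have [le_u _] := place_stage u; apply: leq_ltn_trans le_u _.
rewrite (place_child c); apply: leq_ltn_trans (new_child_gt _ _).
apply/size_prefix/TU_code_prefix.
by move: uv; rewrite -rank_mono; case: (rank v).
Qed.

Lemma place_mono u v : (place u < place v) = (u < v)%O.
Proof.
apply/idP/idP; last exact: place_lt.
case: (ltgtP u v) => // [/place_lt/ltnW|->]; last by rewrite ltnn.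
by rewrite leqNgt => /negPf ->.
Qed.

End Stages.

Lemma tree_of_code_embedding k S c (cP : wf_code c) :
  depth_at_most k S -> prefix (TU_code k #|S|) c ->
  exists tau : S -> tree_of_code cP, embedding tau.
Proof.
move=> S_depth cpre.
have pre (u : S) : prefix (TU_code k (rank u)) c.
  exact: prefix_trans (TU_code_prefix k (ltnW (rank_card u))) cpre.
have le_c (u : S) : place k u < (size c).+1.
  rewrite ltnS; have [le_u _] := place_stage S_depth u.
  exact: leq_trans le_u (size_prefix (pre u)).
pose tau (u : S) : tree_of_code cP := Ordinal (le_c u).
have tau_mono u v : (tau u < tau v)%O = (u < v)%O.
  by rewrite -(place_mono S_depth).
have tau_inj : injective tau.
  move=> u v uv; have := tau_mono u v; have := tau_mono v u.
  by rewrite uv ltxx; case: ltgtP.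
have tau_child u v : child v u -> child (tau v) (tau u).
  move=> cvu; have [le_v dv] := place_stage S_depth v.
  have [le_u nth_u _] := place_child_stage S_depth cvu le_v dv.
  have u_gt0 : 0 < place k u by rewrite (place_child k cvu).
  have lt_u : (place k u).-1 < size (TU_code k (rank u)) by rewrite prednK.
  by rewrite /= /code_child /= u_gt0 (nth_prefix (pre u) lt_u) nth_u eqxx.
exists tau; split=> //.
- by apply: val_inj; rewrite /= place_root.
- by move=> u v; rewrite tau_mono.
move=> u v; split; first exact: tau_child.
(* For the converse, the image of the root has no parent; otherwise the images of [v] and of the
   true parent [w] are both parents of [tau u], so they coincide and injectivity gives [v = w]. *)
have [->|[w cwu]] := root_or_child u.
  have -> : tau (root S) = root _ by apply: val_inj; rewrite /= place_root.
  by rewrite (negPf (root_no_parent _)).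
by move=> /(parent_unique (tau_child _ _ cwu))/tau_inj <-.
Qed.

Theorem theoremB1 (k p : nat) (hk : 1 < k) (S : totree)
    (hdepth : depth_at_most k S) (hcard : #|S| = p) :
  exists tau : S -> U p k, embedding tau.
Proof.
by apply: tree_of_code_embedding hdepth _; rewrite hcard extend_branches_prefix.
Qed.
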